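(* For all integers $m,n\ge0$ set $$G^m(q,\overline q|v):=\sum_{n=0}^\infty\frac{H^Q_{m,n}(q,\overline q)\,v^n}{n!},\qquad G^n(u|q,\overline q):=\sum_{m=0}^\infty\frac{u^m H^Q_{m,n}(q,\overline q)}{m!}.$$ Then for every $u,v,q\in\mathbb H$, $$G^m(q,\overline q|v)=(q-v)^m_{*_R}\,*_R\,e_*^{(\overline q,v)},\qquad G^n(u|q,\overline q)=e_*^{(u,q)}\,*_L\,(\overline q-u)^n_{*_L},$$ where in the first identity the functions are right slice regular functions of $v$ (with $q$ fixed) and in the second they are left slice regular functions of $u$ (with $q$ fixed).
   Context: $\mathbb H$ is the algebra of real quaternions and $\overline q$ is the quaternionic conjugate. For $p,q\in\mathbb H$, $e_*^{(p,q)}:=\sum_{n=0}^\infty\frac{p^nq^n}{n!}$. For integers $m,n\ge0$, $$H^Q_{m,n}(q,\overline q)=\sum_{k=0}^{\min(m,n)}(-1)^k k!\binom mk\binom nk q^{m-k}\overline q^{\,n-k}.$$ Entire right slice regular functions of $v$ are everywhere convergent series $\sum_n a_nv^n$ with $a_n\in\mathbb H$, and their $*_R$-product is $\left(\sum_n a_nv^n\right)*_R\left(\sum_n b_nv^n\right)=\sum_n\left(\sum_{k=0}^n a_kb_{n-k}\right)v^n$. Entire left slice regular functions of $u$ are everywhere convergent series $\sum_n u^na_n$, and their $*_L$-product is $\left(\sum_n u^na_n\right)*_L\left(\sum_n u^nb_n\right)=\sum_n u^n\left(\sum_{k=0}^n a_kb_{n-k}\right)$. $(q-v)^m_{*_R}$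 is the $m$-fold $*_R$-power of $v\mapsto q-v$, and $(\overline q-u)^n_{*_L}$ is the $n$-fold $*_L$-power of $u\mapsto\overline q-u$. *)

(* Defs.v *)
From HB Require Import structures.
From mathcomp Require Import all_boot all_order all_algebra.
From mathcomp Require Import ring.
From mathcomp Require Import all_classical all_reals all_analysis.

Set Implicit Arguments.
Unset Strict Implicit.
Unset Printing Implicit Defensive.

Import Order.TTheory GRing.Theory Num.Theory.
Import numFieldNormedType.Exports.

Local Open Scope classical_set_scope.
Local Open Scope ring_scope.

(* The quaternion a + b i + c j + d k is the row vector (a, b, c, d).  The norm
   inherited from 'rV[R]_4 is the sup norm of the coordinates; it is equivalent
   to the Euclidean one, so limits of sequences and series are the usual ones.
   The library has no ring structure on 'rV[R]_4, so the Hamilton product below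
   does not clash with another product. *)
Definition quat (R : realType) : Type := 'rV[R]_4.

HB.instance Definition _ (R : realType) :=
  NormedModule.copy (quat R) 'rV[R]_4.
HB.instance Definition _ (R : realType) :=
  Complete.copy (quat R) 'rV[R]_4.

Section Quaternions.
Variable R : realType.
Implicit Types p q : quat R.

Definition mkquat (a b c d : R) : quat R := \row_(i < 4) [:: a; b; c; d]`_i.

Definition qre q : R := q ord0 (@Ordinal 4 0 isT).
Definition qim_i q : R := q ord0 (@Ordinal 4 1 isT).
Definition qim_j q : R := q ord0 (@Ordinal 4 2 isT).
Definition qim_k q : R := q ord0 (@Ordinal 4 3 isT).

Definition qone : quat R := mkquat 1 0 0 0.

Definition qmul p q : quat R :=
  let: (a, b, c, d) := (qre p, qim_i p, qim_j p, qim_k p) in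
  let: (a', b', c', d') := (qre q, qim_i q, qim_j q, qim_k q) in
  mkquat (a * a' - b * b' - c * c' - d * d')
         (a * b' + b * a' + c * d' - d * c')
         (a * c' - b * d' + c * a' + d * b')
         (a * d' + b * c' - c * b' + d * a').

Definition qconj q : quat R :=
  mkquat (qre q) (- qim_i q) (- qim_j q) (- qim_k q).

Lemma quatP p q : qre p = qre q -> qim_i p = qim_i q -> qim_j p = qim_j q ->
  qim_k p = qim_k q -> p = q.
Proof.
move=> h0 h1 h2 h3; apply/rowP => -[[|[|[|[|//]]]] Hi].
- by rewrite (_ : Ordinal Hi = @Ordinal 4 0 isT) //; apply/val_inj.
- by rewrite (_ : Ordinal Hi = @Ordinal 4 1 isT) //; apply/val_inj.
- by rewrite (_ : Ordinal Hi = @Ordinal 4 2 isT) //; apply/val_inj.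
- by rewrite (_ : Ordinal Hi = @Ordinal 4 3 isT) //; apply/val_inj.
Qed.

Lemma qmulA : associative qmul.
Proof.
by move=> p q r; apply: quatP;
  rewrite /qmul /mkquat /qre /qim_i /qim_j /qim_k !mxE /=; ring.
Qed.

Lemma qmul1q : left_id qone qmul.
Proof.
by move=> q; apply: quatP;
  rewrite /qmul /qone /mkquat /qre /qim_i /qim_j /qim_k !mxE /=; ring.
Qed.

Lemma qmulq1 : right_id qone qmul.
Proof.
by move=> q; apply: quatP;
  rewrite /qmul /qone /mkquat /qre /qim_i /qim_j /qim_k !mxE /=; ring.
Qed.

Lemma qmulDl : left_distributive qmul +%R.
Proof.
by move=> p q r; apply: quatP;
  rewrite /qmul /mkquat /qre /qim_i /qim_j /qim_k !mxE /=; ring.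
Qed.

Lemma qmulDr : right_distributive qmul +%R.
Proof.
by move=> p q r; apply: quatP;
  rewrite /qmul /mkquat /qre /qim_i /qim_j /qim_k !mxE /=; ring.
Qed.

Lemma qone_neq0 : qone != 0 :> quat R.
Proof.
apply/eqP => /(congr1 qre); rewrite /qone /mkquat /qre !mxE /= => /eqP.
by rewrite oner_eq0.
Qed.

HB.instance Definition _ := GRing.Zmodule_isNzRing.Build (quat R)
  qmulA qmul1q qmulq1 qmulDl qmulDr qone_neq0.

Lemma qscaleAl (a : R) p q : a *: (p * q) = (a *: p) * q.
Proof.
by apply: quatP; rewrite /GRing.mul /= /qmul /mkquat /qre /qim_i /qim_j /qim_k
  !mxE /=; ring.
Qed.

Lemma qscaleAr (a : R) p q : a *: (p * q) = p * (a *: q).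
Proof.
by apply: quatP; rewrite /GRing.mul /= /qmul /mkquat /qre /qim_i /qim_j /qim_k
  !mxE /=; ring.
Qed.

HB.instance Definition _ :=
  GRing.Lmodule_isLalgebra.Build R (quat R) qscaleAl.
HB.instance Definition _ :=
  GRing.Lalgebra_isAlgebra.Build R (quat R) qscaleAr.

End Quaternions.

Section SliceRegular.
Variable R : realType.
Local Notation H := (quat R).
Implicit Types (p q u v : H) (a b : nat -> H) (f g : H -> H) (m n : nat).

Definition estar p q : H :=
  limn (series (fun n => n`!%:R^-1 *: (p ^+ n * q ^+ n))).

Definition hermiteQ m n q : H :=
  \sum_(k < (minn m n).+1)
    ((-1) ^+ k * k`!%:R * 'C(m, k)%:R * 'C(n, k)%:R : R)
      *: (q ^+ (m - k) * qconj q ^+ (n - k)).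

Definition cauchy_coef a b : nat -> H :=
  fun n => \sum_(k < n.+1) a k * b (n - k)%N.

Definition right_expansion a f : Prop :=
  forall v, series (fun n => a n * v ^+ n) @ \oo --> f v.

Definition left_expansion a f : Prop :=
  forall u, series (fun n => u ^+ n * a n) @ \oo --> f u.

Definition entire_right f : Prop := exists a, right_expansion a f.
Definition entire_left f : Prop := exists a, left_expansion a f.

(* The coefficients of an entire slice regular function are unique (they are
   determined by its restriction to the real axis), so the choice made by [get]
   is the only possible one.  The value is arbitrary if [f] is not entire slice
   regular on the relevant side. *)
Definition right_coef f : nat -> H := get [set a | right_expansion a f].
Definition left_coef f : nat -> H := get [set a | left_expansion a f].

(* These products are meaningful for entire slice regular factors; the Cauchy
   product of two everywhere convergent series then converges everywhere. *)
Definition right_mul f g : H -> H := fun v =>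
  limn (series (fun n => cauchy_coef (right_coef f) (right_coef g) n * v ^+ n)).

Definition left_mul f g : H -> H := fun u =>
  limn (series (fun n => u ^+ n * cauchy_coef (left_coef f) (left_coef g) n)).

Definition right_exp f m : H -> H := iter m (right_mul f) (fun=> 1).
Definition left_exp f n : H -> H := iter n (left_mul f) (fun=> 1).

Definition genR_term m q v : nat -> H :=
  fun n => n`!%:R^-1 *: (hermiteQ m n q * v ^+ n).

Definition genR m q v : H := limn (series (genR_term m q v)).

Definition genL_term n u q : nat -> H :=
  fun m => m`!%:R^-1 *: (u ^+ m * hermiteQ m n q).

Definition genL n u q : H := limn (series (genL_term n u q)).

End SliceRegular.

(* Main.v *)
Require Import Defs.
From mathcomp Require Import all_boot all_order all_algebra.
From mathcomp Require Import ring lra.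
From mathcomp Require Import all_classical all_reals all_analysis.

(** Both identities are equalities between coefficient sequences.  Since
    k! C(n,k) / n! = 1 / (n-k)!, the Hermite polynomial satisfies
      H_{m,n} / n! = sum_k (-1)^k C(m,k) q^(m-k) * qbar^(n-k) / (n-k)!,
    the n-th Cauchy coefficient of (-1)^k C(m,k) q^(m-k) and qbar^j / j!
    ([hermite_right_coef]).  The first sequence expands the *-power of q - v,
    because coefficients in q alone commute and Pascal's rule applies
    ([cauchy_binom]); the second expands the *-exponential.  Reversing the
    summation index gives the other identity ([hermite_left_coef]).

    Two analytic facts turn this into a statement about functions.  First, the
    *-product is defined through the coefficients of its factors, which must
    therefore be determined by the function: two expansions of the same function
    differ by a power series that vanishes on the real axis, where t is central,
    so that its lowest nonzero coefficient would be dominated by the tail as t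
    tends to 0 ([powser_real_eq0]).  Second, everything has to converge.  The
    condition |a_n| <= C K^n / n! implies convergence everywhere, holds for
    polynomials and exponentials, and is stable under Cauchy products by the
    binomial theorem ([exp_dominated_cauchy]), so one estimate serves all the
    series involved. *)

Set Implicit Arguments.
Unset Strict Implicit.
Unset Printing Implicit Defensive.

Import Order.TTheory GRing.Theory Num.Theory.
Import numFieldNormedType.Exports.

Local Open Scope classical_set_scope.
Local Open Scope ring_scope.

(** * Norm estimates for quaternions *)

(** The norm is the sup norm of the coordinates, which is not multiplicative:
    each coordinate of a product is a sum of four products, whence the 4. *)
Lemma norm_qmul_le (R : realType) (p q : quat R) :
  `|p * q| <= 4 * `|p| * `|q|.
Proof.
have coord (x : quat R) i : `|x ord0 i| <= `|x|.
  rewrite [leRHS]/Num.norm /= mx_normrE; apply/bigmax_geP; right => /=.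
  by exists (ord0, i).
have M (a b c d : R) x : `|a| <= `|p| * x -> `|b| <= `|p| * x ->
    `|c| <= `|p| * x -> `|d| <= `|p| * x -> `|a + b + c + d| <= 4 * `|p| * x.
  move=> ha hb hc hd; rewrite -mulrA.
  have := ler_normD (a + b + c) d; have := ler_normD (a + b) c.
  by have := ler_normD a b; lra.
rewrite [leLHS]/Num.norm /= mx_normrE; apply: bigmax_le.
  by rewrite !mulr_ge0.
move=> [i j] _ /=; rewrite {i}ord1.
rewrite /GRing.mul /= /qmul /mkquat mxE.
case: j => [[|[|[|[|//]]]] Hi] /=; apply: M;
  by rewrite ?normrN normrM ler_pM// coord.
Qed.

Lemma norm_qexp_le (R : realType) (q : quat R) n :
  `|q ^+ n| <= (4 * `|q|) ^+ n.
Proof.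
elim: n => [|n IH].
  rewrite !expr0 [leLHS]/Num.norm /= mx_normrE;
    apply: bigmax_le => // -[i j] _ /=.
  rewrite /GRing.one /= /qone /mkquat mxE.
  by case: j => [[|[|[|[|//]]]] Hi] /=; rewrite ?normr1 ?normr0.
rewrite !exprS; apply: le_trans (norm_qmul_le _ _) _.
by rewrite ler_wpM2l// mulr_ge0.
Qed.

(** * Power series with a real variable *)

Lemma cvg_series_finsupp (R : realType) (V : normedModType R) (u : nat -> V) N :
  (forall n, (N <= n)%N -> u n = 0) -> series u @ \oo --> \sum_(n < N) u n.
Proof.
move=> u0; have -> : \sum_(n < N) u n = series u N by rewrite seriesEord.
rewrite -(cvg_shiftn N).
suff -> : (fun n => series u (n + N)%N) = (fun=> series u N) by exact: cvg_cst.
apply/funext; elim=> [//|n IH].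
by rewrite addSn seriesSr IH u0 ?leq_addl// addr0.
Qed.

(** Let N be the least index with c N != 0 and let M bound the coefficients.
    For 0 < t <= 1/2 the terms after the N-th add up to at most 2 M t^(N+1), so
    a zero sum forces |c N| <= 2 M t, which fails for small t. *)
Lemma powser_real_eq0 (R : realType) (V : normedModType R) (c : nat -> V) :
  (forall t : R, series (fun n => t ^+ n *: c n) @ \oo --> (0 : V)) ->
  forall n, c n = 0.
Proof.
move=> c0.
have [M M0 cM] : exists2 M : R, 0 < M & forall n, `|c n| <= M.
  have /cvg_seq_bounded/pinfty_ex_gt0[M M0 /= cM] : cvgn c.
    have := cvgP _ (c0 1) => /cvg_series_cvg_0 c1.
    apply/cvg_ex; exists 0; apply: cvg_trans c1.
    suff -> : (fun n => 1 ^+ n *: c n) = c by [].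
    by apply/funext => n; rewrite expr1n scale1r.
  by exists M => // n; apply: cM.
elim/ltn_ind => N IH.
have bound (t : R) : 0 < t -> 2 * t <= 1 -> `|c N| <= 2 * M * t.
  move=> t0 t1.
  (* Subtracting the last power on the right makes the bound on the partial
     sums inductive: as 2 t <= 1, M t^k is at most 2 M t^k - 2 M t^(k+1). *)
  have E m : `|series (fun n => t ^+ n *: c n) (m + N.+1) - t ^+ N *: c N|
      <= 2 * M * t ^+ N.+1 - 2 * M * t ^+ (m + N.+1).
    elim: m => [|m IHm].
      rewrite add0n seriesSr addrK subrr seriesEord /= big1 ?normr0// => i _.
      by rewrite IH// scaler0.
    rewrite addSn seriesSr addrAC; apply: le_trans (ler_normD _ _) _.
    rewrite normrZ (ger0_norm (exprn_ge0 _ (ltW t0))).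
    set x := t ^+ (m + N.+1) in IHm *.
    have x0 : 0 <= x by rewrite exprn_ge0// ltW.
    have xc : x * `|c (m + N.+1)%N| <= M * x by rewrite mulrC ler_wpM2r.
    have tx : (2 * t) * (M * x) <= M * x.
      by rewrite ler_piMl// mulr_ge0// ltW.
    by rewrite (exprS t (m + _)) -/x; lra.
  have lim : (fun m => `|series (fun n => t ^+ n *: c n) (m + N.+1)
      - t ^+ N *: c N|) @ \oo --> `|0 - t ^+ N *: c N|.
    apply: cvg_norm; apply: cvgB; last exact: cvg_cst.
    by rewrite cvg_shiftn.
  have : `|0 - t ^+ N *: c N| <= 2 * M * t ^+ N.+1.
    apply: (cvgr_to_le lim); near=> m.
    by apply: le_trans (E m) _; rewrite gerBl !mulr_ge0// ?exprn_ge0// ltW.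
  rewrite sub0r normrN normrZ (ger0_norm (exprn_ge0 _ (ltW t0))) exprS.
  rewrite (_ : _ * (t * _) = t ^+ N * (2 * M * t)); last by ring.
  by rewrite ler_pM2l ?exprn_gt0.
apply/eqP/negP => /negP; rewrite -normr_gt0 => cN0.
have K0 : 0 < `|c N| + 4 * M by lra.
(* With x = |c N| and this t, the bound becomes x <= M x / (x + 4 M), that is
   x + 4 M <= M; and 2 t <= 1 is clear. *)
have t0 : 0 < `|c N| / (2 * (`|c N| + 4 * M)) by rewrite divr_gt0 ?mulr_gt0.
have := bound _ t0; rewrite !mulrA !ler_pdivlMr ?ler_pdivrMr ?mulr_gt0//.
by move=> /(_ _); nra.
Unshelve. all: by end_near. Qed.

(** * Uniqueness of the coefficients *)

Section Coefficients.
Variable R : realType.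
Local Notation H := (quat R).
Implicit Types (p q u v : H) (a b : nat -> H) (f g : H -> H) (m n : nat).

(** On the real axis the powers of the variable are scalars, so the difference
    of two expansions becomes a real power series with sum 0. *)
Lemma right_coefE a f : right_expansion a f -> right_coef f = a.
Proof.
move=> af.
have bf : right_expansion (right_coef f) f.
  by apply: (@getPex _ [set b | right_expansion b f]); exists a.
apply/funext => n; apply/eqP; rewrite -subr_eq0; apply/eqP.
apply: (@powser_real_eq0 R H (fun k => right_coef f k - a k)) => t.
rewrite (_ : series _ = series (fun k => right_coef f k * (t%:A) ^+ k)
    - series (fun k => a k * (t%:A) ^+ k)).
  by rewrite -(subrr (f t%:A)); apply: cvgB; [exact: bf|exact: af].
rewrite -seriesN -seriesD; congr series; apply/funext => k.
by rewrite -[RHS]/(_ - _) exprZn expr1n -!scalerAr !mulr1 scalerBr.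
Qed.

Lemma left_coefE a f : left_expansion a f -> left_coef f = a.
Proof.
move=> af.
have bf : left_expansion (left_coef f) f.
  by apply: (@getPex _ [set b | left_expansion b f]); exists a.
apply/funext => n; apply/eqP; rewrite -subr_eq0; apply/eqP.
apply: (@powser_real_eq0 R H (fun k => left_coef f k - a k)) => t.
rewrite (_ : series _ = series (fun k => (t%:A) ^+ k * left_coef f k)
    - series (fun k => (t%:A) ^+ k * a k)).
  by rewrite -(subrr (f t%:A)); apply: cvgB; [exact: bf|exact: af].
rewrite -seriesN -seriesD; congr series; apply/funext => k.
by rewrite -[RHS]/(_ - _) exprZn expr1n -!scalerAl !mul1r scalerBr.
Qed.

(** * Coefficients of exponential type *)

(** Unlike mere convergence everywhere, this bound passes to Cauchy products by
    a finite computation, without any theorem on products of series. *)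
Definition exp_dominated a : Prop :=
  exists C K : R, [/\ 0 <= C, 0 <= K & forall n, `|a n| <= C * exp_coeff K n].

Lemma exp_coeff_ge0 (K : R) n : 0 <= K -> 0 <= exp_coeff K n.
Proof. by move=> K0; rewrite /exp_coeff /= divr_ge0 ?exprn_ge0. Qed.

Lemma exp_dominated_cvg a : exp_dominated a -> cvgn (series a).
Proof.
move=> [C [K [C0 K0 aCK]]]; apply: normed_cvg.
apply: (@series_le_cvg _ _ (C *: exp_coeff K)) => [n|n|n|] //=.
- by rewrite mulr_ge0// exp_coeff_ge0.
- by apply: is_cvg_seriesZ; exact: is_cvg_series_exp_coeff.
Qed.

(** Substituting a quaternion multiplies the rate K by 4 |v|, so the domination
    of the coefficients gives that of the terms of the series at every point. *)
Lemma exp_dominated_mulXr a v :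
  exp_dominated a -> exp_dominated (fun n => a n * v ^+ n).
Proof.
move=> [C [K [C0 K0 aCK]]]; exists (4 * C), (K * (4 * `|v|)).
split; rewrite ?mulr_ge0// => n; apply: le_trans (norm_qmul_le _ _) _.
rewrite -!mulrA ler_wpM2l// /exp_coeff /= exprMn mulrAC mulrA.
by rewrite ler_pM// ?aCK// norm_qexp_le.
Qed.

Lemma exp_dominated_mulXl a u :
  exp_dominated a -> exp_dominated (fun n => u ^+ n * a n).
Proof.
move=> [C [K [C0 K0 aCK]]]; exists (4 * C), (K * (4 * `|u|)).
split; rewrite ?mulr_ge0// => n; apply: le_trans (norm_qmul_le _ _) _.
rewrite mulrAC -!mulrA ler_wpM2l// /exp_coeff /= exprMn mulrAC mulrA.
by rewrite ler_pM// ?aCK// norm_qexp_le.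
Qed.

Lemma binom_fact_div k n : (k <= n)%N ->
  n`!%:R^-1 * (k`!%:R * 'C(n, k)%:R) = (n - k)`!%:R^-1 :> R.
Proof.
move=> kn; have f0 j : j`!%:R != 0 :> R by rewrite pnatr_eq0 -lt0n fact_gt0.
have B0 : 'C(n, k)%:R != 0 :> R by rewrite pnatr_eq0 -lt0n bin_gt0.
by rewrite -(bin_fact kn) !natrM; field; rewrite B0 !f0.
Qed.

(** The Cauchy product of C K^n / n! and D L^n / n! is C D (K + L)^n / n! by the
    binomial theorem; the factor 4 comes from [norm_qmul_le]. *)
Lemma exp_dominated_cauchy a b :
  exp_dominated a -> exp_dominated b -> exp_dominated (cauchy_coef a b).
Proof.
move=> [C [K [C0 K0 aCK]]] [D [L [D0 L0 bDL]]].
exists (4 * C * D), (K + L); split; rewrite ?mulr_ge0 ?addr_ge0// => n.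
apply: le_trans (ler_norm_sum _ _ _) _.
rewrite /exp_coeff /= addrC exprDn mulr_suml mulr_sumr; apply: ler_sum => k _.
apply: le_trans (norm_qmul_le _ _) _.
apply: (@le_trans _ _ (4 * (C * exp_coeff K k) * (D * exp_coeff L (n - k)%N))).
  by rewrite ler_pM ?ler_wpM2l// mulr_ge0.
have kn : (k <= n)%N by rewrite -ltnS.
have f0 j : j`!%:R != 0 :> R by rewrite pnatr_eq0 -lt0n fact_gt0.
rewrite /exp_coeff /= -(binom_fact_div kn) -mulr_natr.
by rewrite le_eqVlt; apply/orP; left; apply/eqP; field; rewrite !f0.
Qed.

Lemma right_expansion_lim a : exp_dominated a ->
  right_expansion a (fun v => limn (series (fun n => a n * v ^+ n))).
Proof. by move=> da v; apply/exp_dominated_cvg/exp_dominated_mulXr. Qed.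

Lemma left_expansion_lim a : exp_dominated a ->
  left_expansion a (fun u => limn (series (fun n => u ^+ n * a n))).
Proof. by move=> da u; apply/exp_dominated_cvg/exp_dominated_mulXl. Qed.

Lemma right_expansion_mul a b f g : exp_dominated a -> exp_dominated b ->
  right_expansion a f -> right_expansion b g ->
  right_expansion (cauchy_coef a b) (right_mul f g).
Proof.
move=> da db af bg; rewrite /right_mul (right_coefE af) (right_coefE bg).
exact/right_expansion_lim/exp_dominated_cauchy.
Qed.

Lemma left_expansion_mul a b f g : exp_dominated a -> exp_dominated b ->
  left_expansion a f -> left_expansion b g ->
  left_expansion (cauchy_coef a b) (left_mul f g).
Proof.
move=> da db af bg; rewrite /left_mul (left_coefE af) (left_coefE bg).
exact/left_expansion_lim/exp_dominated_cauchy.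
Qed.

(** * Expansion of the *-exponential *)

Definition expq_coef q n : H := n`!%:R^-1 *: q ^+ n.

Lemma exp_dominated_expq q : exp_dominated (expq_coef q).
Proof.
exists 1, (4 * `|q|); split; rewrite ?mulr_ge0// => n.
rewrite mul1r /expq_coef normrZ ger0_norm ?invr_ge0// /exp_coeff /= mulrC.
by rewrite ler_wpM2r ?invr_ge0// norm_qexp_le.
Qed.

Lemma right_expansion_estar q : right_expansion (expq_coef q) (estar q).
Proof.
suff -> : estar q = fun v => limn (series (fun n => expq_coef q n * v ^+ n)).
  exact/right_expansion_lim/exp_dominated_expq.
apply/funext => v; rewrite /estar; congr (limn (series _)).
by apply/funext => n; rewrite scalerAl.
Qed.

Lemma left_expansion_estar q :
  left_expansion (expq_coef q) (fun w => estar w q).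
Proof.
suff -> : (fun w => estar w q) =
    (fun u => limn (series (fun n => u ^+ n * expq_coef q n))).
  exact/left_expansion_lim/exp_dominated_expq.
apply/funext => v; rewrite /estar; congr (limn (series _)).
by apply/funext => n; rewrite scalerAr.
Qed.

(** * Expansion of the *-powers of q - w *)

(** Both the left and the right *-power of q - w have these coefficients,
    since they only involve powers of the single quaternion q. *)
Definition binom_coef q m n : H :=
  ((-1) ^+ n * 'C(m, n)%:R : R) *: q ^+ (m - n).

Lemma binom_coef_eq0 q m n : (m < n)%N -> binom_coef q m n = 0.
Proof. by move=> mn; rewrite /binom_coef bin_small// mulr0 scale0r. Qed.

Lemma binom_coef0 q m : binom_coef q m 0 = q ^+ m.
Proof. by rewrite /binom_coef expr0 bin0 mulr1 scale1r subn0. Qed.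

Lemma binom_coef11 q : binom_coef q 1 1 = -1.
Proof. by rewrite /binom_coef expr1 binn mulr1 subnn expr0 scaleN1r. Qed.

(** [binom_coef q 1] is the sequence q, -1, 0, 0, ... of coefficients of q - w,
    so the sum has at most two nonzero terms and this is Pascal's rule. *)
Lemma cauchy_binom q m :
  cauchy_coef (binom_coef q 1) (binom_coef q m) = binom_coef q m.+1.
Proof.
apply/funext => -[|n]; rewrite /cauchy_coef.
  rewrite big_ord1 /binom_coef !bin0 !subn0 !expr0 !mulr1 !scale1r.
  by rewrite -exprS.
rewrite big_ord_recl big_ord_recl big1 => [|i _]; last first.
  by rewrite binom_coef_eq0 ?mul0r.
rewrite addr0 /binom_coef /bump /= !bin0 bin1 !subSS !subn0 !expr0 !mul1r.
rewrite scale1r expr1 expr1 mulr1 scaleN1r mulN1r -scalerAr -exprS binS natrD.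
rewrite mulrDr scalerDl; congr (_ + _).
  (* If m <= n, truncated subtraction breaks q * q ^ (m - n.+1) = q ^ (m - n),
     but then C(m, n.+1) = 0. *)
  have [mn|nm] := leqP m n; last by rewrite subnSK.
  by rewrite bin_small ?ltnS// mulr0 !scale0r.
by rewrite exprS mulN1r mulNr scaleNr.
Qed.

(** A direct estimate is needed only for the constant 1 and for q - w; the
    higher powers follow from the stability under Cauchy products. *)
Lemma exp_dominated_binom q m : exp_dominated (binom_coef q m).
Proof.
have lin k : (k <= 1)%N -> exp_dominated (binom_coef q k).
  (* The rate K = 1 suffices: n! = 1 at the only nonzero coefficients n <= 1. *)
  move=> k1; exists (1 + `|q|), 1; split; rewrite ?addr_ge0// => n.
  have [kn|nk] := ltnP k n.
    by rewrite binom_coef_eq0// normr0 mulr_ge0 ?addr_ge0// exp_coeff_ge0.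
  have one : `|1 : H| <= 1 by have := norm_qexp_le q 0; rewrite !expr0.
  have q0 : 0 <= `|q| by [].
  case: k k1 nk => [|[|//]] _; case: n => [|[|//]] // _;
    rewrite /binom_coef /exp_coeff /= !expr1n ?binn ?bin0 ?subn0 ?subnn;
    rewrite ?expr0 ?expr1 ?mulr1 ?scaleN1r ?scale1r ?normrN;
    rewrite ?fact0 ?factS ?muln1 divr1 mulr1; lra.
elim: m => [|m IH]; first exact: lin.
by rewrite -cauchy_binom; apply: exp_dominated_cauchy IH; exact: lin.
Qed.

Lemma right_expansion_binom q m :
  right_expansion (binom_coef q m) (right_exp (fun w => q - w) m).
Proof.
elim: m => [|m IH] /=.
  move=> v; have := @cvg_series_finsupp R H
    (fun n => binom_coef q 0 n * v ^+ n) 1.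
  rewrite big_ord1 binom_coef0 mulr1; apply => n n0.
  by rewrite binom_coef_eq0 ?mul0r.
rewrite -cauchy_binom.
apply: (right_expansion_mul (exp_dominated_binom q 1)
  (exp_dominated_binom q m)) IH.
move=> v; have := @cvg_series_finsupp R H
  (fun n => binom_coef q 1 n * v ^+ n) 2.
rewrite big_ord_recl big_ord1 binom_coef0 binom_coef11 mulr1 mulN1r.
apply => n n0; by rewrite binom_coef_eq0 ?mul0r.
Qed.

Lemma left_expansion_binom q m :
  left_expansion (binom_coef q m) (left_exp (fun w => q - w) m).
Proof.
elim: m => [|m IH] /=.
  move=> v; have := @cvg_series_finsupp R H
    (fun n => v ^+ n * binom_coef q 0 n) 1.
  rewrite big_ord1 binom_coef0 mulr1; apply => n n0.
  by rewrite binom_coef_eq0 ?mulr0.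
rewrite -cauchy_binom.
apply: (left_expansion_mul (exp_dominated_binom q 1)
  (exp_dominated_binom q m)) IH.
move=> v; have := @cvg_series_finsupp R H
  (fun n => v ^+ n * binom_coef q 1 n) 2.
rewrite big_ord_recl big_ord1 binom_coef0 binom_coef11 mul1r mulrN1.
apply => n n0; by rewrite binom_coef_eq0 ?mulr0.
Qed.

(** * Hermite polynomials as Cauchy coefficients *)

(** The binomials vanish beyond min(m,n); the sum can thus be given the range of
    a Cauchy coefficient, up to n on the right side and up to m on the left. *)
Lemma hermite_sum m n l q : (minn m n <= l)%N ->
  hermiteQ m n q = \sum_(k < l.+1)
    ((-1) ^+ k * k`!%:R * 'C(m, k)%:R * 'C(n, k)%:R : R)
      *: (q ^+ (m - k) * qconj q ^+ (n - k)).
Proof.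
move=> mnl; rewrite /hermiteQ.
rewrite -(big_mkord predT (fun k : nat =>
  ((-1) ^+ k * k`!%:R * 'C(m, k)%:R * 'C(n, k)%:R : R)
      *: (q ^+ (m - k) * qconj q ^+ (n - k)))).
rewrite (big_nat_widen _ _ l.+1)// big_mkord.
rewrite [RHS](bigID (fun k : 'I__ => (k < (minn m n).+1)%N)) /=.
rewrite [X in _ = _ + X]big1 ?addr0// => k.
rewrite -leqNgt gtn_min => /orP[] h;
  by rewrite (bin_small h) ?mulr0 ?mul0r scale0r.
Qed.

Lemma scale_mul_scale (s t : R) p q : (s *: p) * (t *: q) = (s * t) *: (p * q).
Proof. by rewrite -scalerAl -scalerAr scalerA. Qed.

(** The k-th terms agree: k! C(n,k) / n! = 1 / (n-k)! leaves the coefficient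
    (-1)^k C(m,k) on q^(m-k) and 1 / (n-k)! on the power of the conjugate. *)
Lemma hermite_right_coef m n q :
  n`!%:R^-1 *: hermiteQ m n q =
  cauchy_coef (binom_coef q m) (expq_coef (qconj q)) n.
Proof.
rewrite (@hermite_sum _ _ n) ?geq_minr// scaler_sumr; apply: eq_bigr => k _.
rewrite /binom_coef /expq_coef scale_mul_scale scalerA; congr (_ *: _).
have kn : (k <= n)%N by rewrite -ltnS.
by rewrite -(@binom_fact_div k n)//; ring.
Qed.

(** Here q carries the exponential and its conjugate the binomial, so the k-th
    term of the Hermite sum is the one of index m - k in the Cauchy sum. *)
Lemma hermite_left_coef m n q :
  m`!%:R^-1 *: hermiteQ m n q =
  cauchy_coef (expq_coef q) (binom_coef (qconj q) n) m.
Proof.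
rewrite (@hermite_sum _ _ m) ?geq_minl// scaler_sumr.
rewrite /cauchy_coef [RHS](reindex_inj rev_ord_inj) /=; apply: eq_bigr => k _.
have km : (k <= m)%N by rewrite -ltnS.
rewrite subSS subKn// /binom_coef /expq_coef scale_mul_scale scalerA.
by congr (_ *: _); rewrite -(@binom_fact_div k m)//; ring.
Qed.

(** * The generating functions *)

Lemma genR_termE m q v : genR_term m q v =
  fun n => cauchy_coef (binom_coef q m) (expq_coef (qconj q)) n * v ^+ n.
Proof.
by apply/funext => n; rewrite /genR_term scalerAl hermite_right_coef.
Qed.

Lemma genL_termE n u q : genL_term n u q =
  fun m => u ^+ m * cauchy_coef (expq_coef q) (binom_coef (qconj q) n) m.
Proof.
by apply/funext => m; rewrite /genL_term scalerAr hermite_left_coef.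
Qed.

End Coefficients.

Theorem theorem5p5 (R : realType) (m n : nat) (u v q : quat R) :
  [/\ cvgn (series (genR_term m q v)),
      entire_right (genR m q),
      entire_right (right_exp (fun w => q - w) m),
      entire_right (estar (qconj q))
    & genR m q v =
      right_mul (right_exp (fun w => q - w) m) (estar (qconj q)) v]
  /\
  [/\ cvgn (series (genL_term n u q)),
      entire_left (fun w => genL n w q),
      entire_left (fun w => estar w q),
      entire_left (left_exp (fun w => qconj q - w) n)
    & genL n u q =
      left_mul (fun w => estar w q) (left_exp (fun w => qconj q - w) n) u].
Proof.
have pE := @right_expansion_binom R q m.
have eE := @right_expansion_estar R (qconj q).
have pE' := @left_expansion_binom R (qconj q) n.
have eE' := @left_expansion_estar R q.
have dR := exp_dominated_cauchy (exp_dominated_binom q m)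
  (exp_dominated_expq (qconj q)).
have dL := exp_dominated_cauchy (exp_dominated_expq q)
  (exp_dominated_binom (qconj q) n).
split; split.
- by rewrite genR_termE; exact/exp_dominated_cvg/exp_dominated_mulXr.
- exists (cauchy_coef (binom_coef q m) (expq_coef (qconj q))) => w.
  by rewrite /genR genR_termE; exact: right_expansion_lim.
- by exists (binom_coef q m).
- by exists (expq_coef (qconj q)).
- by rewrite /genR genR_termE /right_mul (right_coefE pE) (right_coefE eE).
- by rewrite genL_termE; exact/exp_dominated_cvg/exp_dominated_mulXl.
- exists (cauchy_coef (expq_coef q) (binom_coef (qconj q) n)) => w.
  by rewrite /genL genL_termE; exact: left_expansion_lim.
- by exists (expq_coef q).
- by exists (binom_coef (qconj q) n).
- by rewrite /genL genL_termE /left_mul (left_coefE pE') (left_coefE eE').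
Qed.
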